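(* Let $X,E$ be Banach spaces, let $f\in \mathrm{Lip}_0(X,E)$ and let $Z,Y$ be sequence classes. Consider the following assertions: (i) If $(x_n)_{n\in\mathbb{N}},(y_n)_{n\in\mathbb{N}}\in Z(X)$ then $(f(x_n)-f(y_n))_{n\in\mathbb{N}}\in Y(E)$. (ii) The operator $\hat f: Z(X)\to Y(E)$ given by $\hat f((x_n)_{n\in\mathbb{N}})=(f(x_n))_{n\in\mathbb{N}}$ is well-defined (i.e. $(f(x_n))_{n\in\mathbb{N}}\in Y(E)$ for all $(x_n)_{n\in\mathbb{N}}\in Z(X)$). (iii) $\hat f\in \mathrm{Lip}_0(Z(X),Y(E))$ (i.e. $\hat f$ is well-defined and Lipschitz). (iv) There exists $C>0$ such that for all $N\in\mathbb{N}$ and all $(x_1,\ldots,x_N),(y_1,\ldots,y_N)\in X^N$, $$\left\|(f(x_k)-f(y_k))_{k=1}^N\right\|_{Y(E)}\le C\left\|(x_k-y_k)_{k=1}^N\right\|_{Z(X)}.$$ Then (i) $\Leftrightarrow$ (ii) $\Leftarrow$ (iii) $\Rightarrow$ (iv). Moreover, if the sequence classes $Z$ and $Y$ are finitely determined, then (iv) $\Rightarrow$ (iii), and in this case $\mathrm{Lip}(\hat f)=\inf\{C\}$, the infimum being taken over all constants $C$ as in (iv).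
   Context: $\mathbb{K}$ is the scalar field ($\mathbb{R}$ or $\mathbb{C}$). For Banach spaces $X,E$, $\mathrm{Lip}_0(X,E)$ is the Banach space of Lipschitz maps $f:X\to E$ with $f(0)=0$, normed by $\mathrm{Lip}(f)=\sup_{x\ne y}\|f(x)-f(y)\|/\|x-y\|$. A sequence class $Z$ is an assignment that associates to each Banach space $E$ a vector subspace $Z(E)$ of $E^{\mathbb{N}}$ endowed with a complete norm $\|\cdot\|_{Z(E)}$ such that $c_{00}(E)\subseteq Z(E)\subseteq \ell_\infty(E)$ with $\|\cdot\|_\infty\le\|\cdot\|_{Z(E)}$ on $Z(E)$, and $\|e^{(j)}\|_{Z(\mathbb{K})}=1$ for all $j\in\mathbb{N}$. Here $c_{00}(E)$ is the set of finitely supported $E$-valued sequences and $e^{(j)}$ is the scalar sequence with $1$ in coordinate $j$ and $0$ elsewhere. A finite tuple $(x_k)_{k=1}^N$ is identified with the sequence $(x_1,\ldots,x_N,0,0,\ldots)$. A sequence class $Z$ is finitely determined if for every Banach space $E$ and every $(x_n)_{n\in\mathbb{N}}\in E^{\mathbb{N}}$, one has $(x_n)_{n\in\mathbb{N}}\in Z(E)$ if and only if $\sup_{N}\|(x_k)_{k=1}^N\|_{Z(E)}<\infty$, and in this case $\|(x_n)_{n\in\mathbb{N}}\|_{Z(E)}=\sup_N\|(x_k)_{k=1}^N\|_{Z(E)}$. *)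

(* Defs.v *)
From HB Require Import structures.
From mathcomp Require Import all_boot all_order all_algebra.
From mathcomp Require Import complex.
From mathcomp Require Import boolp classical_sets functions cardinality reals.
From mathcomp Require Import topology normedtype.

Set Implicit Arguments.
Unset Strict Implicit.
Unset Printing Implicit Defensive.

Import Order.TTheory GRing.Theory Num.Theory.
Import numFieldNormedType.Exports.

Local Open Scope classical_set_scope.
Local Open Scope ring_scope.

(* The norm of a normedModType K takes its values in K itself, also for
   K = R[i], where x <= y means that y - x is a nonnegative real.  Suprema and
   infima of sets of norms are therefore taken in K for that order: an upper
   bound in R[i] of a nonempty set of reals is real, so they agree with the
   ones computed in R. *)

Variant scalar_kind := RealScalars | ComplexScalars.

Definition scalar_field (R : realType) (k : scalar_kind) : numFieldType :=
  match k with RealScalars => R | ComplexScalars => R[i] end.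

Lemma complex_complete (R : realType) (F : set_system (R[i])^o) :
  ProperFilter F -> cauchy F -> cvg F.
Proof.
move=> FF Fc.
have Rec (g : R[i] -> R) : (forall x y, g (x - y) = g x - g y) ->
    (forall z, `|g z|%:C%C <= `|z|) -> cvg (g @ F).
  move=> gB gle; apply: cauchy_cvg; apply/cauchy_ballP => e e0.
  have eC0 : 0 < e%:C%C by rewrite ltcR.
  have /cauchy_ballP/(_ _ eC0)[[A B]] := Fc.
  move=> /= [FA FB] AB.
  exists (g @` A, g @` B) => /=.
    split=> /=; first by apply: (filterS _ FA) => x Ax; exists x.
    by apply: (filterS _ FB) => x Bx; exists x.
  move=> -[_ _] /= [[x Ax <-] [y By <-]].
  have := AB (x, y) (conj Ax By).
  rewrite /ball /= => xye; rewrite -ltcR -gB.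
  exact: le_lt_trans (gle _) xye.
have cR : cvg (@complex.Re R @ F).
  apply: Rec => [[a b] [c d]//|z]; exact: normc_ge_Re.
have cI : cvg (@complex.Im R @ F).
  apply: Rec => [[a b] [c d]//|z].
  have := normc_ge_Re (z * 'i%C); rewrite ReiNIm normrN normrM.
  suff -> : `|'i%C : R[i]| = 1 by rewrite mulr1.
  by rewrite normc_def /= expr0n expr1n add0r sqrtr1.
apply/cvg_ex; exists (Complex (lim (@complex.Re R @ F)) (lim (@complex.Im R @ F))).
apply/cvgrPdist_lt => /= e; rewrite ltcE /= => /andP[/eqP ie re].
have e20 : 0 < complex.Re e / 2 by rewrite divr_gt0.
have eE : e = (complex.Re e / 2)%:C%C + (complex.Re e / 2)%:C%C.
  by rewrite -rmorphD /= -splitr; case: e ie {re e20} => a b /= ->.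
have /cvgrPdist_lt /(_ _ e20) FR := cR.
have /cvgrPdist_lt /(_ _ e20) FI := cI.
apply: filterS2 FR FI => -[a b] /= aR bI.
set l1 := lim _ in aR *; set l2 := lim _ in bI *.
have -> : Complex l1 l2 - Complex a b =
    (l1 - a)%:C%C + 'i%C * (l2 - b)%:C%C.
  by rewrite -[RHS]/(Complex _ _) /=; simpc.
rewrite eE; apply: (le_lt_trans (ler_normD _ _)).
have ni : `|'i%C : R[i]| = 1.
  by rewrite normc_def /= expr0n expr1n add0r sqrtr1.
have nr (r : R) : `|r%:C%C| = `|r|%:C%C.
  by rewrite normc_def /= expr0n addr0 sqrtr_sqr.
by rewrite normrM ni mul1r !nr; apply: ltrD; rewrite ltcR.
Qed.

Definition scalar_banach (R : realType) (k : scalar_kind) : Type :=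
  (scalar_field R k)^o.

HB.instance Definition _ (R : realType) (k : scalar_kind) :=
  NormedModule.on (scalar_banach R k).

Lemma scalar_complete (R : realType) (k : scalar_kind)
    (F : set_system (scalar_banach R k)) :
  ProperFilter F -> cauchy F -> cvg F.
Proof.
case: k F => F; [exact: R_complete | exact: complex_complete].
Qed.

HB.instance Definition _ (R : realType) (k : scalar_kind) :=
  Uniform_isComplete.Build (scalar_banach R k) (@scalar_complete R k).

(* A vector subspace of E^N endowed with a norm.  The function [seq_norm] is
   total; its values outside [seq_set] are unconstrained and irrelevant. *)
Record normed_seq_space (K : numFieldType) (E : lmodType K) := NormedSeqSpace {
  seq_set : set (nat -> E);
  seq_norm : (nat -> E) -> K;
  seq_set0 : seq_set 0;
  seq_setP : forall (a : K) (x y : nat -> E),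
    seq_set x -> seq_set y -> seq_set (a *: x + y);
  seq_normD : forall x y : nat -> E, seq_set x -> seq_set y ->
    seq_norm (x + y) <= seq_norm x + seq_norm y;
  seq_normZ : forall (a : K) (x : nat -> E), seq_set x ->
    seq_norm (a *: x) = `|a| * seq_norm x;
  seq_norm0_eq0 : forall x : nat -> E, seq_set x -> seq_norm x = 0 -> x = 0
}.

Section SeqType.
Variables (K : numFieldType) (E : lmodType K) (V : normed_seq_space E).

Definition seq_pred : {pred nat -> E} := fun x => x \in seq_set V.

Definition seq_type := {x : nat -> E | x \in seq_pred}.

Lemma seq_pred_submod : submod_closed seq_pred.
Proof.
split=> [|a x y]; first exact/mem_set/seq_set0.
by move=> /set_mem xV /set_mem yV; exact/mem_set/seq_setP.
Qed.

HB.instance Definition _ := GRing.isSubmodClosed.Build K (nat -> E) seq_pred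
  seq_pred_submod.
HB.instance Definition _ := SubChoice.on seq_type.
HB.instance Definition _ := [SubChoice_isSubLmodule of seq_type by <:].

Lemma seq_valP (x : seq_type) : seq_set V (\val x).
Proof. exact/set_mem/(valP x). Qed.

Let norm (x : seq_type) : K := seq_norm V (\val x).

Let normD x y : norm (x + y) <= norm x + norm y.
Proof. by apply: seq_normD; exact: seq_valP. Qed.

Let normZ a x : norm (a *: x) = `|a| * norm x.
Proof. by apply: seq_normZ; exact: seq_valP. Qed.

Let norm0_eq0 x : norm x = 0 -> x = 0.
Proof.
by move=> /(seq_norm0_eq0 (seq_valP x)) x0; apply: val_inj; rewrite x0.
Qed.

HB.instance Definition _ := Lmodule_isNormed.Build K seq_type
  normD normZ norm0_eq0.

End SeqType.

Definition unit_seq (R : realType) (k : scalar_kind) (j : nat) :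
  nat -> scalar_banach R k := fun n => (n == j)%:R : scalar_field R k.

Record seq_class (R : realType) (k : scalar_kind) := SeqClass {
  seq_space : forall E : completeNormedModType (scalar_field R k),
    normed_seq_space E;
  seq_complete : forall (E : completeNormedModType (scalar_field R k))
    (F : set_system (seq_type (seq_space E))),
    ProperFilter F -> cauchy F -> cvg F;
  c00_seq : forall (E : completeNormedModType (scalar_field R k))
    (x : nat -> E),
    finite_set [set n | x n != 0] -> seq_set (seq_space E) x;
  seq_bounded : forall (E : completeNormedModType (scalar_field R k))
    (x : nat -> E),
    seq_set (seq_space E) x -> has_ubound [set `|x n| | n in setT];
  sup_norm_le : forall (E : completeNormedModType (scalar_field R k))
    (x : nat -> E), seq_set (seq_space E) x ->
    supremum 0 [set `|x n| | n in setT] <= seq_norm (seq_space E) x;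
  unit_seq_norm : forall j : nat,
    seq_norm (seq_space (scalar_banach R k)) (unit_seq R k j) = 1
}.

Definition seq_banach (R : realType) (k : scalar_kind) (Z : seq_class R k)
  (E : completeNormedModType (scalar_field R k)) := seq_type (seq_space Z E).

HB.instance Definition _ (R : realType) (k : scalar_kind) (Z : seq_class R k)
    (E : completeNormedModType (scalar_field R k)) :=
  NormedModule.on (seq_banach Z E).
HB.instance Definition _ (R : realType) (k : scalar_kind) (Z : seq_class R k)
    (E : completeNormedModType (scalar_field R k)) :=
  Uniform_isComplete.Build (seq_banach Z E) (@seq_complete R k Z E).

Definition tuple_seq (E : nmodType) (N : nat) (x : 'I_N -> E) : nat -> E :=
  fun n => if insub n is Some i then x i else 0.

Definition tuple_norm (R : realType) (k : scalar_kind) (Z : seq_class R k)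
    (E : completeNormedModType (scalar_field R k)) (N : nat)
    (x : 'I_N -> E) : scalar_field R k :=
  seq_norm (seq_space Z E) (tuple_seq x).

Definition section_norms (R : realType) (k : scalar_kind) (Z : seq_class R k)
    (E : completeNormedModType (scalar_field R k)) (x : nat -> E) :
    set (scalar_field R k) :=
  [set tuple_norm Z (fun i : 'I_N => x i) | N in setT].

Definition finitely_determined (R : realType) (k : scalar_kind)
    (Z : seq_class R k) : Prop :=
  forall (E : completeNormedModType (scalar_field R k)) (x : nat -> E),
    (seq_set (seq_space Z E) x <-> has_ubound (section_norms Z x)) /\
    (seq_set (seq_space Z E) x ->
       seq_norm (seq_space Z E) x = supremum 0 (section_norms Z x)).

Definition Lip0 (K : numFieldType) (X E : normedModType K) : set (X -> E) :=
  [set f | f 0 = 0 /\ lipschitz f].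

Definition Lip (K : numFieldType) (X E : normedModType K) (f : X -> E) : K :=
  supremum 0 [set `|f p.1 - f p.2| / `|p.1 - p.2| |
    p in [set p : X * X | p.1 != p.2]].

Section Assertions.
Variables (R : realType) (k : scalar_kind).
Variables (X E : completeNormedModType (scalar_field R k)).
Variables (Z Y : seq_class R k) (f : X -> E).

Definition preserves_differences : Prop :=
  forall x y : nat -> X,
    seq_set (seq_space Z X) x -> seq_set (seq_space Z X) y ->
    seq_set (seq_space Y E) (fun n => f (x n) - f (y n)).

Definition hat_well_defined : Prop :=
  forall x : nat -> X, seq_set (seq_space Z X) x ->
    seq_set (seq_space Y E) (fun n => f (x n)).

Lemma hat_proof (wd : hat_well_defined) (x : seq_banach Z X) :
  (fun n => f (\val x n)) \in seq_pred (seq_space Y E).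
Proof. by apply/mem_set/wd/seq_valP. Qed.

Definition hat (wd : hat_well_defined) (x : seq_banach Z X) :
  seq_banach Y E := exist _ (fun n => f (\val x n)) (hat_proof wd x).

Definition hat_Lip0 : Prop :=
  exists wd : hat_well_defined, Lip0 (hat wd).

Definition finite_Lip_constants : set (scalar_field R k) :=
  [set C | 0 < C /\
    forall (N : nat) (x y : 'I_N -> X),
      tuple_norm Y (fun i => f (x i) - f (y i)) <=
      C * tuple_norm Z (fun i => x i - y i)].

End Assertions.

(* Main.v *)
(** Truncation is the whole argument.  If [hat f] is Lipschitz, apply it to
    finitely supported sequences; [f 0 = 0] makes the tails vanish.  Conversely,
    the finite inequalities bound the norms of all sections of
    [(f x_n - f y_n)_n] by [C] times the norm of [x - y], and finite
    determination of both classes passes to the supremum over the sections.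
    Hence the constants of (iv) are exactly the positive Lipschitz constants of
    [hat f], whose infimum is [Lip (hat f)]. *)
Require Import Defs.
From mathcomp Require Import all_boot all_order all_algebra.
From mathcomp Require Import complex cardinality.
From mathcomp Require Import boolp classical_sets reals topology normedtype.

Import Order.TTheory GRing.Theory Num.Theory.
Import numFieldNormedType.Exports.

Local Open Scope classical_set_scope.
Local Open Scope ring_scope.

(** [supremum] is a choice among the least upper bounds. Antisymmetry leaves at most one, so a
    partial order such as that of [R[i]] suffices. *)
Lemma supremum_unique {d} {T : porderType d} (x0 s : T) (A : set T) :
  A !=set0 -> supremums A s -> supremum x0 A = s.
Proof.
move=> /set0P/negPf A0 As; rewrite /supremum A0.
by case: xgetP => [y _ Ay|/(_ s)//]; exact: is_subset1_supremums Ay As.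
Qed.

Lemma infimum_unique {d} {T : porderType d} (x0 s : T) (A : set T) :
  A !=set0 -> infimums A s -> infimum x0 A = s.
Proof.
move=> /set0P/negPf A0 As; rewrite /infimum A0.
by case: xgetP => [y _ Ay|/(_ s)//]; exact: is_subset1_infimums Ay As.
Qed.

(** Nonnegative elements of [R[i]] are real, so the complex case reduces to completeness of [R]
    through real parts. *)
Lemma scalar_supremumP {R : realType} {k : scalar_kind}
    (A : set (scalar_field R k)) :
  A !=set0 -> has_ubound A -> (forall x, A x -> 0 <= x) ->
  supremums A (supremum 0 A).
Proof.
move=> A0 uA Age0.
suff [s As] : supremums A !=set0 by rewrite (supremum_unique 0 s).
case: k A A0 uA Age0 => /= A A0 [u uA] Age0.
  exists (sup A); split.
    by apply: sup_upper_bound; split=> //; exists u.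
  by move=> v vA; exact: ge_sup.
have ReA x : A x -> x = (complex.Re x)%:C%C.
  by move=> /Age0; rewrite lecE => /andP[/eqP/= ix _]; case: x ix => ? ? /= ->.
exists (sup (@complex.Re R @` A))%:C%C; split=> [x Ax|v vA].
  rewrite [leLHS](ReA x Ax) lecR; apply: sup_upper_bound; last by exists x.
  split; first by case: A0 => y Ay; exists (complex.Re y), y.
  exists (complex.Re u) => _ [y Ay <-].
  by have := uA y Ay; rewrite lecE => /andP[].
(* Lying above one real element forces [v] to be real. *)
have [a Aa] := A0.
rewrite lecE /=; apply/andP; split.
  by have := vA a Aa; rewrite (ReA a Aa) lecE /= => /andP[].
apply: ge_sup; first by exists (complex.Re a), a.
by move=> _ [y Ay <-]; have := vA y Ay; rewrite lecE => /andP[].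
Qed.

Section LipschitzConstant.
Context {R : realType} {k : scalar_kind}.
Context {X E : normedModType (scalar_field R k)} (f : X -> E).
Local Notation K := (scalar_field R k).

Let quotients : set K := [set `|f p.1 - f p.2| / `|p.1 - p.2| |
  p in [set p : X * X | p.1 != p.2]].

Lemma Lip_le (C : K) : 0 <= C ->
  (forall x y, `|f x - f y| <= C * `|x - y|) -> Lip f <= C.
Proof.
move=> C0 fC; rewrite /Lip -/quotients.
(* If [X] is trivial there are no quotients and [Lip f] is the default [0]. *)
have [->|/set0P Q0] := eqVneq quotients set0; first by rewrite supremum0.
have uC : ubound quotients C.
  move=> _ [[x y] /= xy <-].
  by rewrite ler_pdivrMr ?fC// normr_gt0 subr_eq0.
apply: (scalar_supremumP _ Q0 _ _).2 => //; first by exists C.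
by move=> _ [p _ <-]; exact: divr_ge0.
Qed.

(** The constant [C] bounds the quotients, which makes [Lip f] a genuine supremum rather than a
    default value. *)
Lemma Lip_ge (C : K) x y :
  (forall x y, `|f x - f y| <= C * `|x - y|) ->
  `|f x - f y| <= Lip f * `|x - y|.
Proof.
move=> fC; have [->|xy] := eqVneq x y; first by rewrite !subrr !normr0 mulr0.
have Qxy : quotients (`|f x - f y| / `|x - y|) by exists (x, y).
rewrite -ler_pdivrMr ?normr_gt0 ?subr_eq0//.
apply: (scalar_supremumP quotients _ _ _).1 => //.
- by eexists; exact: Qxy.
- exists C => _ [[a b] /= ab <-].
  by rewrite ler_pdivrMr ?fC// normr_gt0 subr_eq0.
- by move=> _ [p _ <-]; exact: divr_ge0.
Qed.

Lemma Lip_ge0 (C : K) :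
  (forall x y, `|f x - f y| <= C * `|x - y|) -> 0 <= Lip f.
Proof.
move=> fC; have [Q0|/set0P[_ [[x y] /= xy _]]] := eqVneq quotients set0.
  by rewrite /Lip -/quotients Q0 supremum0.
have := le_trans (normr_ge0 _) (Lip_ge C x y fC).
by rewrite pmulr_lge0// normr_gt0 subr_eq0.
Qed.

End LipschitzConstant.

(** Nonnegativity is not a field of the record; it is inherited from the normed module
    [seq_type V]. *)
Lemma seq_norm_ge0 {K : numFieldType} {E : lmodType K}
    (V : normed_seq_space E) (x : nat -> E) :
  seq_set V x -> 0 <= seq_norm V x.
Proof. by move=> /mem_set Vx; exact: (normr_ge0 (exist _ x Vx : seq_type V)). Qed.

Lemma seq_setB {K : numFieldType} {E : lmodType K}
    (V : normed_seq_space E) (x y : nat -> E) :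
  seq_set V x -> seq_set V y -> seq_set V (fun n => x n - y n).
Proof.
move=> Vx Vy; have := seq_setP (-1) Vy Vx.
congr seq_set; apply/funext => n /=.
by rewrite /GRing.add/= /GRing.scale/= scaleN1r addrC.
Qed.

Section SequenceClass.
Context {R : realType} {k : scalar_kind} (Z : seq_class R k).
Context {E : completeNormedModType (scalar_field R k)}.

Lemma seq_set_tuple (N : nat) (x : 'I_N -> E) :
  seq_set (seq_space Z E) (tuple_seq x).
Proof.
apply: c00_seq; apply: (sub_finite_set _ (finite_II N)) => n /=.
by rewrite /tuple_seq; case: insubP => [//|_]; rewrite eqxx.
Qed.

Lemma section_norms_ge0 (x : nat -> E) a : section_norms Z x a -> 0 <= a.
Proof. by move=> [N _ <-]; apply: seq_norm_ge0; exact: seq_set_tuple. Qed.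

Lemma section_norms_supremum (x : nat -> E) :
  has_ubound (section_norms Z x) ->
  supremums (section_norms Z x) (supremum 0 (section_norms Z x)).
Proof.
move=> ux; apply: scalar_supremumP => //; last exact: section_norms_ge0.
by exists (tuple_norm Z (fun i : 'I_0 => x i)), 0%N.
Qed.

End SequenceClass.

Section FiniteConstants.
Context {R : realType} {k : scalar_kind}.
Context {X E : completeNormedModType (scalar_field R k)} (f : X -> E).
Context (Z Y : seq_class R k).
Local Notation K := (scalar_field R k).

Lemma finite_Lip_constants_hat (wd : hat_well_defined Z Y f) (C : K) :
  f 0 = 0 -> 0 < C ->
  (forall x y, `|hat wd x - hat wd y| <= C * `|x - y|) ->
  finite_Lip_constants Z Y f C.
Proof.
move=> f0 C0 fC; split=> // N x y.
(* Padding by zeros turns tuples into points of [Z(X)]; it remains to compare coordinates, those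
   past [N] being zero. *)
pose T (z : 'I_N -> X) : seq_banach Z X :=
  exist _ (tuple_seq z) (mem_set (seq_set_tuple Z N z)).
have := fC (T x) (T y); congr (_ <= C * _); rewrite /tuple_norm /Num.norm/=.
- congr seq_norm; apply/funext => n /=.
  rewrite /tuple_seq /GRing.add/= /GRing.opp/=.
  by case: insubP => // _; rewrite f0 subrr.
- congr seq_norm; apply/funext => n /=.
  rewrite /tuple_seq /GRing.add/= /GRing.opp/=.
  by case: insubP => // _; rewrite subrr.
Qed.

(** One bound on the section norms yields both membership and estimate. The case [y = 0] gives
    well-definedness of [hat], the general case its Lipschitz bound. *)
Lemma finite_Lip_constants_bound (C : K) (x y : nat -> X) :
  finitely_determined Z -> finitely_determined Y ->
  finite_Lip_constants Z Y f C ->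
  seq_set (seq_space Z X) (fun n => x n - y n) ->
  seq_set (seq_space Y E) (fun n => f (x n) - f (y n)) /\
  seq_norm (seq_space Y E) (fun n => f (x n) - f (y n)) <=
    C * seq_norm (seq_space Z X) (fun n => x n - y n).
Proof.
move=> fdZ fdY [C0 fC] xyZ.
have [[/(_ xyZ) uZ _] /(_ xyZ) normZ] := fdZ X (fun n => x n - y n).
have uY : ubound (section_norms Y (fun n => f (x n) - f (y n)))
    (C * seq_norm (seq_space Z X) (fun n => x n - y n)).
  move=> _ [N _ <-].
  apply: le_trans (fC N (fun i => x i) (fun i => y i)) _.
  (* After cancelling [C > 0], a section norm is compared with the supremum of all of them. *)
  rewrite ler_pM2l// normZ.
  by apply: (section_norms_supremum Z _ uZ).1; exists N.
have [[_ inY] normY] := fdY E (fun n => f (x n) - f (y n)).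
have xyY : seq_set (seq_space Y E) (fun n => f (x n) - f (y n)).
  by apply: inY; eexists; exact: uY.
split=> //; rewrite normY//; apply: (section_norms_supremum Y _ _).2 => //.
by eexists; exact: uY.
Qed.

Lemma hat_bound (wd : hat_well_defined Z Y f) (C : K) :
  finitely_determined Z -> finitely_determined Y ->
  finite_Lip_constants Z Y f C ->
  forall x y, `|hat wd x - hat wd y| <= C * `|x - y|.
Proof.
move=> fdZ fdY fC x y.
have xyZ := seq_setB _ _ _ (seq_valP x) (seq_valP y).
exact: (finite_Lip_constants_bound C _ _ fdZ fdY fC xyZ).2.
Qed.

Lemma finite_Lip_constants_well_defined (C : K) :
  f 0 = 0 -> finitely_determined Z -> finitely_determined Y ->
  finite_Lip_constants Z Y f C -> hat_well_defined Z Y f.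
Proof.
move=> f0 fdZ fdY fC x xZ.
have /(finite_Lip_constants_bound C x (fun=> 0) fdZ fdY fC)[+ _] :
    seq_set (seq_space Z X) (fun n => x n - 0).
  by move: xZ; congr seq_set; apply/funext => n; rewrite subr0.
by congr seq_set; apply/funext => n; rewrite f0 subr0.
Qed.

Lemma hat0 (wd : hat_well_defined Z Y f) : f 0 = 0 -> hat wd 0 = 0.
Proof. by move=> f0; apply: val_inj; apply/funext => n /=. Qed.

End FiniteConstants.

Theorem theorem2p1 (R : realType) (k : scalar_kind)
    (X E : completeNormedModType (scalar_field R k)) (f : X -> E)
    (Z Y : seq_class R k) :
  Lip0 f ->
  [/\ preserves_differences Z Y f <-> hat_well_defined Z Y f,
      hat_Lip0 Z Y f -> hat_well_defined Z Y f,
      hat_Lip0 Z Y f -> finite_Lip_constants Z Y f !=set0 &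
      finitely_determined Z -> finitely_determined Y ->
      finite_Lip_constants Z Y f !=set0 ->
      hat_Lip0 Z Y f /\
      forall wd : hat_well_defined Z Y f,
        Lip (hat wd) = infimum 0 (finite_Lip_constants Z Y f)].
Proof.
move=> [f0 _]; split.
- split=> [fB x xZ|wd x y xZ yZ]; last exact: seq_setB (wd _ xZ) (wd _ yZ).
  (* The second sequence is taken to be zero. *)
  have := fB x _ xZ (seq_set0 _).
  by congr seq_set; apply/funext => n; rewrite f0 subr0.
- by case.
- move=> [wd [_ [M [Mreal fM]]]].
  (* [lipschitz] grants every constant above some real [M]; this one is also positive. *)
  have M1 : M < `|M| + 1 by rewrite (le_lt_trans (real_ler_norm _))// ltrDl.
  exists (`|M| + 1); apply: (finite_Lip_constants_hat f Z Y wd) => //.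
    by rewrite ltr_wpDl.
  by move=> x y; exact: (fM _ M1 (x, y)).
- move=> fdZ fdY [C fC].
  have wdf := finite_Lip_constants_well_defined f Z Y C f0 fdZ fdY fC.
  split=> [|wd].
    exists wdf; split; first exact: hat0.
    apply: (@klipschitzW _ _ _ C) => [|[x y] _].
      (* The filter on pairs is proper because [(0, 0)] is a pair of points. *)
      exact: (@globally_properfilter _ _ (0, 0)).
    exact: (hat_bound f Z Y wdf C fdZ fdY fC).
  have hatC := hat_bound f Z Y wd C fdZ fdY fC.
  symmetry; apply: infimum_unique; first by exists C.
  split=> [D fD|L lbL].
    by apply: Lip_le; [case: fD => /ltW|exact: hat_bound fD].
  (* [Lip (hat wd)] may be [0], whereas the constants of (iv) are positive; adding any [e > 0] makes
     it admissible. *)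
  apply/ler_addgt0Pr => e e0; apply: lbL.
  apply: (finite_Lip_constants_hat f Z Y wd) => //.
    by rewrite ltr_wpDl// (Lip_ge0 _ C).
  move=> x y; apply: (le_trans (Lip_ge _ C x y hatC)).
  by rewrite ler_wpM2r// lerDl ltW.
Qed.
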